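(* Let $(x_n)_{n\in\mathbb{N}}$ be a sequence of finite binary trees with $\lim_{n\to\infty}|x_n|=\infty$. Then $(x_n)$ converges in the subtree size topology (i.e. $\lim_{n\to\infty}t(x_n,u)$ exists for all $u\in\mathbb{V}$) if and only if the sequence of probability measures $(\mu_{x_n})_{n\in\mathbb{N}}$ on $\mathbb{V}_\infty$ converges weakly; and in that case, if $\mu_{x_n}\to\mu$ weakly, then $\lim_{n\to\infty}t(x_n,u)=\mu(B_u)$ for all $u\in\mathbb{V}$.
   Context: $\mathbb{V}=\bigsqcup_{k\ge0}\{0,1\}^k$ is the set of finite $0$-$1$ words, with concatenation $u+v$, appending letters $u0,u1$, and prefix order. A finite binary tree is a finite prefix-stable subset $x\subseteq\mathbb{V}$ (if $(v_1,\dots,v_k)\in x$, $k>0$, then $(v_1,\dots,v_{k-1})\in x$); $|x|$ is its number of nodes. $t(x,u)=\frac{1}{|x|}|\{v\in\mathbb{V}: u+v\in x\}|$. The external boundary of $x$ is $\partial x=\{v\in\mathbb{V}\setminus x:\ v=w0 \text{ or } v=w1 \text{ for some } w\in x\}$ (it has $|x|+1$ elements when $x\neq\emptyset$). $\mathbb{V}_\infty=\{0,1\}^{\mathbb{N}}$ carries the ultrametric $d(v,w)=2^{-|v\wedge w|}$, where $|v\wedge w|$ is the length of the longest common prefix, making it a compact metric space whose Borel $\sigma$-field is generated by the coordinate projections; weak convergence of probability measures refers to this space. $B_u=\{v\in\mathbb{V}_\infty: u\text{ is a prefix of }v\}$. For $v=(v_1,\dots,v_k)\in\mathbb{V}$,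 $\mathrm{unif}(B_v)$ denotes the law of $(v_1,\dots,v_k,\eta_1,\eta_2,\dots)$ with $\eta_i$ i.i.d. uniform on $\{0,1\}$. For a finite binary tree $x$, $\mu_x=\frac{1}{|x|+1}\sum_{v\in\partial x}\mathrm{unif}(B_v)$. *)

(* Defs.v *)
From HB Require Import structures.
From mathcomp Require Import all_boot all_order all_algebra.
From mathcomp Require Import finmap.
From mathcomp Require Import all_classical all_reals all_analysis.

Set Implicit Arguments.
Unset Strict Implicit.
Unset Printing Implicit Defensive.

Import Order.TTheory GRing.Theory Num.Theory.
Import numFieldNormedType.Exports.
Local Open Scope classical_set_scope.
Local Open Scope ring_scope.

Definition word := seq bool.

(** A finite binary tree: a finite set of words that is prefix-stable. *)
Definition prefix_stable (x : {fset word}) : Prop :=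
  forall (v : word) (b : bool), (rcons v b \in x)%fset -> (v \in x)%fset.

Definition tree_card (x : {fset word}) : nat := #|` x|%fset.

(** t(x,u) = |{v : u ++ v \in x}| / |x|; the set {v | u ++ v \in x} is in
    bijection (v |-> u ++ v) with the set of elements of x having u as a
    prefix, whose cardinality we count. *)
Definition tfrac (R : realType) (x : {fset word}) (u : word) : R :=
  (#|` [fset w in x | prefix u w]|%fset)%:R / (tree_card x)%:R.

Definition boundary (x : {fset word}) : {fset word} :=
  ([fset rcons w b | w in x, b in [fset false; true]] `\` x)%fset.

Definition coord_sets : set (set (nat -> bool)) :=
  [set A | exists (i : nat) (b : bool), A = [set w | w i = b]].

Definition Vinf := g_sigma_algebraType coord_sets.

Definition cyl (u : word) : set Vinf :=
  [set w | forall i, (i < size u)%N -> w i = nth false u i].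

Definition lcp (v w : Vinf) : nat :=
  match pselect (exists i, v i != w i) with
  | left h => ex_minn h
  | right _ => 0%N
  end.

Definition dist (R : realType) (v w : Vinf) : R :=
  if pselect (exists i, v i != w i) then (2^-1) ^+ (lcp v w) else 0.

Definition dcontinuous (R : realType) (f : Vinf -> R) : Prop :=
  forall (v : Vinf) (e : R), 0 < e -> exists2 delta : R, 0 < delta &
    forall w : Vinf, dist R v w < delta -> `|f v - f w| < e.

Definition bounded_fun (R : realType) (f : Vinf -> R) : Prop :=
  exists M : R, forall v, `|f v| <= M.

Definition prepend (v : word) (w : Vinf) : Vinf :=
  fun i => if (i < size v)%N then nth false v i else w (i - size v)%N.

Lemma measurable_prepend (v : word) : measurable_fun setT (prepend v).
Proof.
apply: (@measurability _ _ _ _ setT (prepend v) coord_sets) => //.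
move=> _ [_ [i [b ->]] <-].
rewrite setTI.
rewrite /prepend /preimage.
case: (ltnP i (size v)) => hi.
  case: (eqVneq (nth false v i) b) => [<-|nb].
    rewrite (_ : [set _ | _] = setT); first exact: measurableT.
    by apply/seteqP; split=> w //= _; rewrite hi.
  rewrite (_ : [set _ | _] = set0); first exact: measurable0.
  by apply/seteqP; split=> w //=; rewrite hi => /eqP; rewrite (negbTE nb).
apply: sub_sigma_algebra; exists (i - size v)%N, b.
by apply/seteqP; split=> w /=; rewrite ltnNge hi.
Qed.

HB.instance Definition _ (v : word) :=
  isMeasurableFun.Build _ _ Vinf Vinf (prepend v) (measurable_prepend v).

(** A "fair coin" measure: the law of an i.i.d. uniform {0,1}-sequence,
    characterized by its finite-dimensional distributions. *)
Definition fair_coin (R : realType) (lam : probability Vinf R) : Prop :=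
  forall u : word, lam (cyl u) = ((2^-1 : R) ^+ size u)%:E.

(** unif(B_v) = law of (v_1,...,v_k,eta_1,...) = pushforward of lam. *)
Definition unif (R : realType) (lam : probability Vinf R) (v : word) :=
  distribution lam (prepend v).

Definition mu_tree (R : realType) (lam : probability Vinf R)
    (x : {fset word}) : {measure set Vinf -> \bar R} :=
  let bd := enum_fset (boundary x) in
  mscale ((((tree_card x).+1)%:R : R)^-1)%:nng
    (msum (fun k => unif lam (nth [::] bd k)) (size bd)).

Definition weak_cvg (R : realType) (mus : nat -> {measure set Vinf -> \bar R})
    (mu : {measure set Vinf -> \bar R}) : Prop :=
  forall f : Vinf -> R, bounded_fun f -> dcontinuous f ->
    (fun n => (\int[mus n]_w (f w)%:E)%E) @ \oo --> (\int[mu]_w (f w)%:E)%E.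

(* Main.v *)
(** Multiplying [mu_x (B_u)] by [|x| + 1] gives an additive function of [u]
    which equals 1 on the boundary, an antichain.  Downward induction on the
    depth then gives [|x_u| + 1] for [u] in [x], where [x_u] is the subtree
    rooted at [u]; outside [x] the value is at most 1 by monotonicity.  Hence
    [|mu_x (B_u) - t(x, u)| <= 1 / (|x| + 1)], and everything reduces to the
    equivalence of weak convergence with convergence on cylinders.  One
    direction holds because indicators of cylinders are continuous.  For the
    other, the limits on cylinders extend to a probability measure, obtained as
    the image of Lebesgue measure on [[0, 1)] under nested interval subdivision,
    and continuous functions are uniformly approximated by functions of finitely
    many coordinates. *)

Require Import Defs.
From HB Require Import structures.
From mathcomp Require Import all_boot all_order all_algebra.
From mathcomp Require Import finmap.
From mathcomp Require Import all_classical all_reals all_analysis.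
From mathcomp Require Import measurable_realfun.
From mathcomp Require Import ring lra.
Import Order.TTheory GRing.Theory Num.Theory.
Import numFieldNormedType.Exports.
Local Open Scope classical_set_scope.
Local Open Scope ring_scope.

(** * Cylinder sets *)

Lemma cylP (u : word) (w : Vinf) : cyl u w <-> mkseq w (size u) = u.
Proof.
split=> [h|<- i]; last by rewrite size_mkseq => hi; rewrite nth_mkseq.
apply: (@eq_from_nth _ false) => [|i]; rewrite size_mkseq // => hi.
by rewrite nth_mkseq // h.
Qed.

Lemma cyl_nil : cyl [::] = setT.
Proof. by apply/seteqP; split. Qed.

Lemma cyl_rcons (u : word) (b : bool) :
  cyl (rcons u b) = cyl u `&` [set w | w (size u) = b].
Proof.
apply/seteqP; split=> w /=.
  move=> /cylP; rewrite size_rcons mkseqS => /rcons_inj[h1 h2].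
  by split => //; apply/cylP.
by case=> /cylP h1 h2; apply/cylP; rewrite size_rcons mkseqS h1 h2.
Qed.

Lemma cyl_split (u : word) : cyl u = cyl (rcons u false) `|` cyl (rcons u true).
Proof.
rewrite !cyl_rcons -setIUr [X in _ `&` X](_ : _ = setT) ?setIT //.
by apply/seteqP; split=> w //= _; case: (w _); [right|left].
Qed.

Lemma cyl_disj (u : word) : cyl (rcons u false) `&` cyl (rcons u true) = set0.
Proof. by rewrite !cyl_rcons; apply/seteqP; split=> w //= [[_ ->] []]. Qed.

Lemma measurable_coord (i : nat) (b : bool) : measurable [set w : Vinf | w i = b].
Proof. by apply: sub_sigma_algebra; exists i, b. Qed.

Lemma measurable_cyl (u : word) : measurable (cyl u).
Proof.
elim/last_ind: u => [|u b ih]; first by rewrite cyl_nil; exact: measurableT.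
by rewrite cyl_rcons; apply: measurableI => //; exact: measurable_coord.
Qed.

Lemma sub_cyl (u v : word) : prefix u v -> cyl v `<=` cyl u.
Proof.
move=> /prefixP[s ->] w h i hi.
by rewrite h ?nth_cat ?hi // size_cat ltn_addr.
Qed.

(** Both words are initial segments of [w], so the shorter is a prefix of the longer. *)
Lemma cyl_prefix (u v : word) (w : Vinf) : cyl u w -> cyl v w ->
  prefix u v || prefix v u.
Proof.
move=> /cylP <- /cylP <-; have h a b : (a <= b)%N -> prefix (mkseq w a) (mkseq w b).
  by move=> ab; rewrite prefixE size_mkseq -map_take take_iota; rewrite (minn_idPl ab).
by case/orP: (leq_total (size u) (size v)) => /h -> //; rewrite orbT.
Qed.

Lemma measure_cyl_split {R : realType} (mu : {measure set Vinf -> \bar R}) (u : word) :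
  mu (cyl u) = (mu (cyl (rcons u false)) + mu (cyl (rcons u true)))%E.
Proof.
rewrite [in LHS]cyl_split measureU ?cyl_disj //; exact: measurable_cyl.
Qed.

Lemma measurable_prepend_cyl (v u : word) : measurable (prepend v @^-1` cyl u).
Proof.
rewrite -[X in measurable X]setTI; apply: measurable_prepend => //.
exact: measurable_cyl.
Qed.

(** * Subtree sizes and the mass that the boundary measure of a tree gives to cylinders *)

Lemma prefix_split (u w : word) :
  (prefix u w = (u == w) + (prefix (rcons u false) w + prefix (rcons u true) w) :> nat)%N.
Proof.
elim: u w => [|a u ih] [|[] w] //=; rewrite ?prefix0s // eqseq_cons.
  by case: (a == true); rewrite //= ih.
by case: (a == false); rewrite //= ih.
Qed.

Section tree_mass.
Variables (R : realType) (lam : probability Vinf R) (x : {fset word}).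
Hypothesis x_tree : prefix_stable x.

Definition subtree_card (u : word) : nat := #|` [fset w in x | prefix u w]|%fset.

Lemma subtree_cardE (u : word) :
  subtree_card u = (\sum_(w <- x) prefix u w)%N.
Proof.
rewrite /subtree_card card_fset_sum1 big_fset /= big_mkcond /=.
by apply: eq_bigr => w _; case: prefix.
Qed.

Lemma tree_prefix {u v : word} : prefix u v -> v \in x -> u \in x.
Proof.
move=> /prefixP[s ->]; elim/last_ind: s => [|s b ih]; first by rewrite cats0.
by rewrite -rcons_cat => /x_tree.
Qed.

Lemma subtree_card_split (u : word) : u \in x ->
  subtree_card u =
  (subtree_card (rcons u false) + subtree_card (rcons u true)).+1.
Proof.
move=> ux; have -> : forall n, n.+1 = (n + \sum_(w <- x) (u == w))%N.
  by move=> n; rewrite (big_fsetD1 u) //= eqxx big1_fset ?addn1 // => w;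
     rewrite in_fsetD1 eq_sym => /andP[/negbTE ->].
rewrite !subtree_cardE addnC -!big_split /=; apply: eq_bigr => w _.
exact: prefix_split.
Qed.

Lemma subtree_card_notin (u : word) : u \notin x -> subtree_card u = 0%N.
Proof.
move=> ux; rewrite subtree_cardE big_seq big1 // => w wx.
by apply/eqP; rewrite eqb0; apply: contra ux => /tree_prefix; apply.
Qed.

Lemma mem_boundary (v : word) :
  reflect (v \notin x /\ exists2 w, w \in x & exists b, v = rcons w b)
          (v \in boundary x).
Proof.
rewrite /boundary in_fsetD; apply: (iffP andP) => -[vx].
  by move=> /imfset2P[w wx [b _ e]]; split => //; exists w => //; exists b.
move=> [w wx [b e]]; split => //; apply/imfset2P; exists w => //.
by exists b => //; rewrite !inE; case: (b).
Qed.

(** A proper prefix of [rcons w b] is a prefix of [w], hence lies in [x] by prefix stability, while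
    boundary words lie outside [x]. *)
Lemma boundary_antichain (u v : word) :
  u \in boundary x -> v \in boundary x -> prefix u v -> u = v.
Proof.
move=> /mem_boundary[ux _] /mem_boundary[_ [w wx [b ->]]] /prefixP[s].
case/lastP: s => [|s c]; first by rewrite cats0.
rewrite -rcons_cat => /rcons_inj[e _]; case/negP: ux.
by apply: tree_prefix wx; rewrite e prefix_prefix.
Qed.

(** This is [(|x| + 1) mu_x (B_u)], left unnormalised so that cylinders of boundary words weigh
    exactly 1. *)
Definition mass (u : word) : R :=
  \sum_(v <- boundary x) fine (lam (prepend v @^-1` cyl u)).

Lemma mu_treeE (u : word) :
  mu_tree lam x (cyl u) = (mass u / (tree_card x).+1%:R)%:E.
Proof.
rewrite /mu_tree /mscale /msum /= /mscale /= /mass EFinM muleC; congr (_ * _)%E.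
rewrite (big_nth [::]) -sumEFin big_mkord; apply: eq_bigr => k _.
rewrite /unif /distribution /pushforward fineK // fin_num_measure //.
exact: measurable_prepend_cyl.
Qed.

Lemma mass_split (u : word) : mass u = mass (rcons u false) + mass (rcons u true).
Proof.
rewrite /mass -big_split; apply: eq_bigr => v _ /=.
rewrite -fineD ?fin_num_measure //; try exact: measurable_prepend_cyl.
by congr fine; exact: (measure_cyl_split (distribution lam (prepend v))).
Qed.

Lemma prepend_cyl (v : word) (w : Vinf) : cyl v (prepend v w).
Proof. by move=> i hi; rewrite /prepend hi. Qed.

Lemma mass_boundary (u : word) : u \in boundary x -> mass u = 1.
Proof.
move=> ux; rewrite /mass (big_fsetD1 u) //= big1_fset ?addr0.
  rewrite (_ : _ @^-1` _ = setT) ?probability_setT //.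
  by apply/seteqP; split=> // w _; exact: prepend_cyl.
move=> v; rewrite in_fsetD1 => /andP[/eqP vu vx] _.
rewrite (_ : _ @^-1` _ = set0) ?measure0 //.
apply/seteqP; split=> // w /= /cyl_prefix/(_ (prepend_cyl v w)).
by case/orP => /boundary_antichain; [move/(_ ux vx)|move/(_ vx ux)] => ?; subst.
Qed.

Lemma mass_in (u : word) : u \in x -> mass u = (subtree_card u).+1%:R.
Proof.
(* [k] bounds how deep [x] reaches below [u], so induction on [k] climbs from the leaves; for
   [k = 0] the bound is absurd at [w = u]. *)
have [k] : exists k, forall w, w \in x -> (size w < size u + k)%N.
  exists (\max_(w <- x) size w).+1 => w wx.
  by rewrite addnS ltnS; apply: leq_trans (leq_addl _ _); apply: leq_bigmax_seq.
elim: k u => [u /(_ u)|k ih u hk ux]; first by rewrite addn0 ltnn => h /h.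
(* A child outside [x] is a boundary word of mass 1 with an empty subtree, so the formula extends to
   it. *)
have step b : mass (rcons u b) = (subtree_card (rcons u b)).+1%:R.
  case: (boolP (rcons u b \in x)) => ubx; first apply: ih => // w /hk.
    by rewrite size_rcons addSnnS.
  rewrite subtree_card_notin // mass_boundary //; apply/mem_boundary.
  by split=> //; exists u => //; exists b.
by rewrite mass_split !step (subtree_card_split u) // -natrD addSn addnS.
Qed.

Lemma mass_mono (u v : word) : prefix u v -> mass v <= mass u.
Proof.
move=> uv; apply: ler_sum => w _; apply: fine_le.
- by rewrite fin_num_measure //; exact: measurable_prepend_cyl.
- by rewrite fin_num_measure //; exact: measurable_prepend_cyl.
- apply: le_measure; rewrite ?inE; try exact: measurable_prepend_cyl.
  by apply: preimage_subset; exact: sub_cyl.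
Qed.

Lemma mass_ge0 (u : word) : 0 <= mass u.
Proof. by apply: sumr_ge0 => v _; exact: fine_ge0. Qed.

(** The path from the root to [u] leaves [x] through a boundary word, of mass 1, and [mass] does not
    increase along the path. A nonempty [x] contains the root. *)
Lemma mass_notin (u : word) : x != fset0 -> u \notin x -> mass u <= 1.
Proof.
move=> /fset0Pn[w /(tree_prefix (prefix0s w)) x0].
elim/last_ind: u => [|u b ih] ux; first by rewrite x0 in ux.
case: (boolP (u \in x)) => uxx.
  by rewrite mass_boundary //; apply/mem_boundary; split=> //; exists u => //; exists b.
by apply: le_trans (ih uxx); apply: mass_mono; exact: prefix_rcons.
Qed.

Lemma mu_tree_setT : x != fset0 -> mu_tree lam x setT = 1%E.
Proof.
move=> x0; have [w /(tree_prefix (prefix0s w)) xnil] := fset0Pn _ x0.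
rewrite -cyl_nil mu_treeE mass_in // [subtree_card _](_ : _ = tree_card x).
  by rewrite divff ?pnatr_eq0.
rewrite subtree_cardE /tree_card card_fset_sum1.
by apply: eq_bigr => v _; rewrite prefix0s.
Qed.

Lemma mu_tree_tfrac (u : word) : x != fset0 ->
  `|fine (mu_tree lam x (cyl u)) - tfrac R x u| <= (tree_card x).+1%:R^-1.
Proof.
move=> x0; rewrite mu_treeE /= /tfrac -/(subtree_card u).
have m0 : (0 < tree_card x)%N by rewrite cardfs_gt0.
have m0' : 0 < (tree_card x)%:R :> R by rewrite ltr0n.
case: (boolP (u \in x)) => ux; last first.
  rewrite subtree_card_notin // mul0r subr0 ger0_norm ?divr_ge0 ?mass_ge0 //.
  by rewrite ler_piMl ?invr_ge0 // mass_notin.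
rewrite mass_in // -!natr1; set s := (subtree_card u)%:R; set m := (tree_card x)%:R.
have sm : s <= m by rewrite ler_nat fsubset_leq_card // fset_sub.
(* The error is [1 - s / m], a number in [0, 1], divided by [m + 1]. *)
have -> : (s + 1) / (m + 1) - s / m = (1 - s / m) * (m + 1)^-1 by field; lra.
have : 0 <= s / m <= 1 by rewrite divr_ge0 ?ler_pdivrMr ?mul1r.
move=> /andP[h0 h1].
rewrite ger0_norm ?mulr_ge0 ?invr_ge0; try lra.
by rewrite ler_piMl ?invr_ge0; lra.
Qed.

End tree_mass.

(** * The ultrametric and continuity in terms of common initial segments *)

Lemma dist_agree {R : realType} (k : nat) (v w : Vinf) :
  dist R v w < 2^-1 ^+ k -> forall i, (i < k)%N -> v i = w i.
Proof.
rewrite /dist /lcp; case: pselect => [h|h] /=; last first.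
  by move=> _ i _; apply/eqP; apply: contra_notT h => nvw; exists i.
(* [m] is the first index of disagreement; the distance bound gives [k < m]. *)
case: ex_minnP => m vwm hm; rewrite ltr_iXn2l ?invr_gt0 ?invf_lt1 ?ltr1n // => km i ik.
apply/eqP; apply: contraTT (ltn_trans ik km) => vwi; rewrite -leqNgt; exact: hm.
Qed.

Lemma agree_dist {R : realType} (k : nat) (v w : Vinf) :
  (forall i, (i < k)%N -> v i = w i) -> dist R v w <= 2^-1 ^+ k.
Proof.
move=> vw; rewrite /dist /lcp; case: pselect => [h|h] /=; last by rewrite exprn_ge0 ?invr_ge0.
case: ex_minnP => m vwm hm; rewrite ler_wiXn2l ?invr_ge0 ?invf_le1 ?ler1n //.
by rewrite leqNgt; apply/negP => /vw e; rewrite e eqxx in vwm.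
Qed.

Lemma cyl_agree (u : word) (v w : Vinf) :
  cyl u v -> cyl u w -> forall i, (i < size u)%N -> v i = w i.
Proof. by move=> uv uw i iu; rewrite uv ?uw. Qed.

Lemma dcontinuous_agree {R : realType} (f : Vinf -> R) (v : Vinf) (e : R) :
  dcontinuous f -> 0 < e -> exists k : nat, forall w : Vinf,
    (forall i, (i < k)%N -> v i = w i) -> `|f v - f w| < e.
Proof.
move=> fc e0; have [d d0 hd] := fc v e e0.
have [k kd] : exists k : nat, 2^-1 ^+ k < d.
  have /cvgrPdist_lt/(_ _ d0)[k _ /(_ k (leqnn k))] :
    (fun n => 2^-1 ^+ n : R) @ \oo --> 0.
    by apply: cvg_expr; rewrite ger0_norm ?invr_ge0 // invf_lt1 ?ltr1n.
  by rewrite /= sub0r normrN ger0_norm ?exprn_ge0 ?invr_ge0 // => h; exists k.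
by exists k => w vw; apply/hd/(le_lt_trans _ kd)/agree_dist.
Qed.

(** Cylinders are open and closed: points closer than [2^-|u|] share their first [|u|] letters. *)
Lemma dcontinuous_indic {R : realType} (u : word) : dcontinuous (\1_(cyl u) : Vinf -> R).
Proof.
move=> v e e0; exists (2^-1 ^+ size u); first by rewrite exprn_gt0 ?invr_gt0.
move=> w /dist_agree vw; suff -> : \1_(cyl u) v = \1_(cyl u) w :> R by rewrite subrr normr0.
rewrite !indicE; congr (_%:R); congr nat_of_bool.
by apply/idP/idP; rewrite !inE => h i iu; rewrite -h // vw.
Qed.

Lemma bounded_indic {R : realType} (u : word) : Defs.bounded_fun (\1_(cyl u) : Vinf -> R).
Proof. by exists 1 => v; rewrite indicE; case: (_ \in _); rewrite ?normr0 ?normr1. Qed.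

(* Koenig's lemma: if the claim fails on [cyl u], it fails on one of its two
   halves, and continuity is violated at the limit of the resulting path. *)
Lemma dcontinuous_uniform {R : realType} (f : Vinf -> R) (e : R) :
  dcontinuous f -> 0 < e -> exists k : nat, forall v w : Vinf,
    (forall i, (i < k)%N -> v i = w i) -> `|f v - f w| < e.
Proof.
move=> fc e0.
pose good u := exists k : nat, forall v w : Vinf, cyl u v ->
  (forall i, (i < k)%N -> v i = w i) -> `|f v - f w| < e.
suff [k hk] : good [::] by exists k => v w; apply: hk.
apply: contrapT => bad.
(* The implication sits under the existential so that [choice] yields a total function [b]. *)
have ext u : exists b, ~ good u -> ~ good (rcons u b).
  apply: contrapT => h.
  have {}h b : ~ good u /\ good (rcons u b).
    by apply: contrapT => g; apply: h; exists b => nu nb; apply: g; split=> //; exact: contrapT.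
  have [[nu [k0 h0]] [_ [k1 h1]]] := (h false, h true).
  apply: nu; exists (maxn k0 k1) => v w; rewrite cyl_split => -[] uv vw.
    by apply: h0 => // i ik; apply: vw; rewrite leq_max ik.
  by apply: h1 => // i ik; apply: vw; rewrite leq_max ik orbT.
have [b hb] := choice ext.
pose path k := iter k (fun u => rcons u (b u)) [::].
have size_path k : size (path k) = k by elim: k => //= k ih; rewrite size_rcons ih.
have bad_path k : ~ good (path k) by elim: k => //= k ih; exact: hb.
pose p : Vinf := fun i => b (path i).
have cyl_path k : cyl (path k) p.
  by elim: k => [|k ih]; [rewrite cyl_nil | rewrite /= cyl_rcons size_path].
(* Both [v] and [w] will be compared with the limit point [p], hence [e / 2]. *)
have [k hk] := dcontinuous_agree f p (e / 2) fc ltac:(lra).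
(* On [cyl (path k)] all points agree with [p] up to [k], so [k] itself is a modulus there. *)
apply: (bad_path k); exists k => v w pv vw.
have pv' i : (i < k)%N -> p i = v i.
  by move=> ik; apply: (cyl_agree (path k)) => //; rewrite size_path.
have h1 := hk v pv'; have h2 := hk w (fun i ik => etrans (pv' i ik) (vw i ik)).
have -> : f v - f w = (f p - f w) - (f p - f v) by ring.
by apply: le_lt_trans (ler_normB _ _) _; lra.
Qed.

(** * Approximation by functions of finitely many coordinates *)

Definition head_pad (u : word) : Vinf := fun i => nth false u i.

(** Samples [f] once in each cylinder of length [k], at the point continued by [false], so that the
    integral involves only finitely many cylinder measures. *)
Definition step_approx {R : realType} (f : Vinf -> R) (k : nat) (w : Vinf) : R :=
  \sum_(u : k.-tuple bool) f (head_pad u) * \1_(cyl u) w.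

(** The cylinders of length [k] partition the space, so a single term survives. *)
Lemma step_approxE {R : realType} (f : Vinf -> R) (k : nat) (w : Vinf) :
  step_approx f k w = f (head_pad (mkseq w k)).
Proof.
have hs : size (mkseq w k) == k by rewrite size_mkseq.
rewrite /step_approx (bigD1 (Tuple hs)) //= big1 ?addr0 => [|u nu].
  by rewrite indicE mem_set ?mulr1 //; apply/cylP; rewrite size_mkseq.
rewrite indicE memNset ?mulr0 // => /cylP uw; case/eqP: nu; apply: val_inj.
by rewrite /= -uw size_tuple.
Qed.

Lemma agree_step (k : nat) (w : Vinf) (i : nat) : (i < k)%N ->
  w i = head_pad (mkseq w k) i.
Proof. by move=> ik; rewrite /head_pad nth_mkseq. Qed.

Lemma measurable_step {R : realType} (f : Vinf -> R) (k : nat) :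
  measurable_fun setT (step_approx f k).
Proof.
apply: measurable_sum => u; apply: measurable_funM => //.
by apply: measurable_indic; exact: measurable_cyl.
Qed.

(** By continuity, [f] is the pointwise limit of its measurable step approximations. *)
Lemma dcontinuous_measurable {R : realType} (f : Vinf -> R) :
  dcontinuous f -> measurable_fun setT f.
Proof.
move=> fc; apply: (measurable_fun_cvg (h := step_approx f)) => [k|w _].
  exact: measurable_step.
apply/cvgrPdist_lt => e e0; have [k hk] := dcontinuous_agree f w e fc e0.
exists k => // n /= kn; rewrite step_approxE; apply: hk => i ik.
by apply: agree_step; exact: leq_trans ik kn.
Qed.

Lemma bounded_fun_integrable {R : realType} (mu : {measure set Vinf -> \bar R})
  (f : Vinf -> R) : (mu setT < +oo)%E -> measurable_fun setT f ->
  Defs.bounded_fun f -> mu.-integrable setT (EFin \o f).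
Proof.
move=> mufin mf [M hM]; apply: measurable_bounded_integrable => //.
exists M; split; last by move=> N MN w _; exact: le_trans (hM w) (ltW MN).
exact/ger0_real/(le_trans (normr_ge0 _) (hM point)).
Qed.

Lemma Rintegral_step {R : realType} (mu : {measure set Vinf -> \bar R}) (f : Vinf -> R)
  (k : nat) : (mu setT < +oo)%E ->
  (\int[mu]_w step_approx f k w)%R =
  \sum_(u : k.-tuple bool) f (head_pad u) * fine (mu (cyl u)).
Proof.
move=> mufin.
have ind_int u : mu.-integrable setT (EFin \o (\1_(cyl u) : Vinf -> R)).
  apply: bounded_fun_integrable => //; last exact: bounded_indic.
  by apply: measurable_indic; exact: measurable_cyl.
have int u : mu.-integrable setT (EFin \o (fun w => f (head_pad u) * \1_(cyl u) w)).
  exact: (integrableZl measurableT (f (head_pad u)) (ind_int u)).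
rewrite /Rintegral /step_approx.
under eq_integral do rewrite -sumEFin.
rewrite (integral_sum measurableT (fun u : k.-tuple bool => int u)) //.
rewrite -sum_fine; last by move=> u _; apply: integrable_fin_num.
apply: eq_bigr => u _; rewrite -[LHS]/(Rintegral mu setT (fun w => f (head_pad u) * \1_(cyl u) w)).
rewrite RintegralZl // /Rintegral integral_indic ?setIT //; exact: measurable_cyl.
Qed.

Lemma dcontinuous_integrable {R : realType} (mu : {measure set Vinf -> \bar R})
  (f : Vinf -> R) : (mu setT < +oo)%E -> Defs.bounded_fun f -> dcontinuous f ->
  mu.-integrable setT (EFin \o f).
Proof.
move=> mufin fb fc; apply: bounded_fun_integrable => //.
exact: dcontinuous_measurable.
Qed.

(** Total mass 1 carries the uniform bound over to the integrals. The estimate is the same for every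
    such [mu], so one [k] serves a whole sequence of measures. *)
Lemma integral_step_le {R : realType} (mu : {measure set Vinf -> \bar R})
  (f : Vinf -> R) (k : nat) (e : R) :
  mu setT = 1%E -> Defs.bounded_fun f -> dcontinuous f ->
  (forall v w : Vinf, (forall i, (i < k)%N -> v i = w i) -> `|f v - f w| < e) ->
  `|(\int[mu]_w f w)%R - \sum_(u : k.-tuple bool) f (head_pad u) * fine (mu (cyl u))| <= e.
Proof.
move=> mu1 fb fc fe; have mufin : (mu setT < +oo)%E by rewrite mu1 ltry.
have fint := dcontinuous_integrable mu f mufin fb fc.
have sint : mu.-integrable setT (EFin \o step_approx f k).
  apply: bounded_fun_integrable => //; first exact: measurable_step.
  by have [M hM] := fb; exists M => w; rewrite step_approxE.
rewrite -Rintegral_step // -RintegralB //.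
have dint : mu.-integrable setT (EFin \o (fun w => f w - step_approx f k w)).
  exact: (integrableB measurableT fint sint).
apply: le_trans (le_normr_Rintegral _ dint) _ => //.
have -> : e = (\int[mu]_w cst e w)%R.
  by rewrite Rintegral_cst // mu1 mulr1.
apply: le_Rintegral => //.
- exact: integrable_norm.
- by apply: bounded_fun_integrable => //; exists `|e|.
- move=> w _; rewrite step_approxE; apply/ltW/fe => i ik; exact: agree_step.
Qed.

(** * Weak convergence and convergence on cylinders *)

Lemma weak_cvg_cyl {R : realType} (mus : nat -> {measure set Vinf -> \bar R})
  (mu : probability Vinf R) :
  (\forall n \near \oo, mus n setT = 1%E) ->
  (forall u, (fun n => fine (mus n (cyl u))) @ \oo --> fine (mu (cyl u))) ->
  weak_cvg mus mu.
Proof.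
move=> mus1 hcyl f fb fc.
have mu1 : mu setT = 1%E := probability_setT mu.
have finE (nu : {measure set Vinf -> \bar R}) : nu setT = 1%E ->
    (\int[nu]_w (f w)%:E = (\int[nu]_w f w)%R%:E)%E.
  move=> nu1; rewrite /Rintegral fineK //; apply: integrable_fin_num => //.
  by apply: dcontinuous_integrable => //; rewrite nu1 ltry.
rewrite finE //.
have : (fun n => (\int[mus n]_w f w)%R) @ \oo --> (\int[mu]_w f w)%R.
  apply/cvgrPdist_le => e e0.
  (* One third of [e] for each of the two step approximations, one for the difference of the step
     sums. *)
  have [k hk] := dcontinuous_uniform f (e / 3) fc ltac:(lra).
  pose S (nu : {measure set Vinf -> \bar R}) :=
    \sum_(u : k.-tuple bool) f (head_pad u) * fine (nu (cyl u)).
  have hS : S \o mus @ \oo --> S mu.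
    by apply: cvg_big => [|u _]; [exact: add_continuous|apply: cvgM; [exact: cvg_cst|exact: hcyl]].
  move/cvgrPdist_le : hS => /(_ (e / 3) ltac:(lra)) hS.
  near=> n.
  have h1 := integral_step_le mu f k (e / 3) mu1 fb fc hk.
  have musn : mus n setT = 1%E by near: n.
  have h2 := integral_step_le (mus n) f k (e / 3) musn fb fc hk.
  have h3 : `|S mu - S (mus n)| <= e / 3 by near: n.
  rewrite -/(S mu) in h1; rewrite -/(S (mus n)) in h2.
  have -> : (\int[mu]_w f w)%R - (\int[mus n]_w f w)%R =
   ((\int[mu]_w f w)%R - S mu) + (S mu - S (mus n)) - ((\int[mus n]_w f w)%R - S (mus n)) by ring.
  apply: le_trans (ler_normB _ _) _.
  by have := ler_normD ((\int[mu]_w f w)%R - S mu) (S mu - S (mus n)); lra.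
move=> h; apply: cvg_EFin; last exact: h.
by near=> n; rewrite finE //; near: n.
Unshelve. all: by end_near. Qed.

Lemma cvg_cyl_weak {R : realType} (mus : nat -> {measure set Vinf -> \bar R})
  (mu : probability Vinf R) (u : word) :
  weak_cvg mus mu -> (fun n => fine (mus n (cyl u))) @ \oo --> fine (mu (cyl u)).
Proof.
move=> /(_ _ (bounded_indic u) (dcontinuous_indic u)).
rewrite integral_indic ?setIT //; last exact: measurable_cyl.
have -> : (fun n => \int[mus n]_w (\1_(cyl u) w)%:E)%E = (fun n => mus n (cyl u)).
  by apply/funext => n; rewrite integral_indic ?setIT //; exact: measurable_cyl.
move=> h; apply: fine_cvg; rewrite fineK ?fin_num_measure //; exact: measurable_cyl.
Qed.

(** * Coding reals by nested interval subdivision *)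

Section descent.
Variables (R : realType) (g : word -> R).

(* The word reached after [k] subdivisions, and the offset of [t] from the left
   endpoint of the interval, of length [g u], attached to that word [u]. *)
Fixpoint descent_state (t : R) (k : nat) : word * R :=
  if k is k'.+1 then
    let: (u, r) := descent_state t k' in
    let c := g (rcons u false) in
    if r < c then (rcons u false, r) else (rcons u true, r - c)
  else ([::], t).

(** A generalised binary expansion: each digit tells whether [t] lies in the right part of the
    current interval. For [g u = 2^-|u|] these are the binary digits of [t] in [0, 1). *)
Definition descent (t : measurableTypeR R) : Vinf := fun i =>
  g (rcons (descent_state t i).1 false) <= (descent_state t i).2.

Lemma descent_stateS (t : R) (k : nat) : descent_state t k.+1 =
  (rcons (descent_state t k).1 (descent t k),
   (descent_state t k).2 -
     (if descent t k then g (rcons (descent_state t k).1 false) else 0)).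
Proof.
rewrite /= /descent; case: (descent_state t k) => u r /=.
by rewrite leNgt; case: ifP => //= _; rewrite subr0.
Qed.

Lemma mkseq_descent (t : R) (k : nat) : mkseq (descent t) k = (descent_state t k).1.
Proof. by elim: k => // k ih; rewrite mkseqS descent_stateS ih. Qed.

(** [a] plays the left endpoint of the interval of [u]; it moves only when the right part is chosen,
    by the length of the left part. *)
Lemma descent_offset_rcons (u : word) (a : R) (b : bool) :
  (forall t : R, cyl u (descent t) -> (descent_state t (size u)).2 = t - a) ->
  forall t : R, cyl (rcons u b) (descent t) ->
    (descent_state t (size (rcons u b))).2 =
    t - (a + (if b then g (rcons u false) else 0)).
Proof.
move=> ha t; rewrite cyl_rcons size_rcons descent_stateS => -[ut /= ->].
by rewrite ha // -mkseq_descent (cylP _ _).1 //; case: b; ring.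
Qed.

Lemma descent_offset (u : word) : exists a : R, forall t : R,
  cyl u (descent t) -> (descent_state t (size u)).2 = t - a.
Proof.
elim/last_ind: u => [|u b [a ha]]; first by exists 0 => t _; rewrite subr0.
by eexists; exact: descent_offset_rcons ha.
Qed.

(** Where the code of [t] starts with [u] the offset is [t - a], so the next digit is a threshold
    test on [t]. *)
Lemma preimage_descent_rcons (u : word) (a : R) (b : bool) :
  (forall t : R, cyl u (descent t) -> (descent_state t (size u)).2 = t - a) ->
  descent @^-1` cyl (rcons u b) =
  descent @^-1` cyl u `&`
    [set t : R | t \in let c := a + g (rcons u false) in
                        if b then `[c, +oo[ else `]-oo, c[].
Proof.
move=> ha; rewrite cyl_rcons; apply/seteqP; split=> t /= [ut tb]; split=> //; move: tb;
  rewrite /descent ha // -mkseq_descent (cylP _ _).1 //.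
  by case: b => /= h; rewrite in_itv /= ?andbT; move: h => /negP; lra.
by case: b; rewrite in_itv /= ?andbT => h; apply/negP; lra.
Qed.

Lemma measurable_descent_cyl (u : word) : measurable (descent @^-1` cyl u).
Proof.
elim/last_ind: u => [|u b ih]; first by rewrite cyl_nil preimage_setT.
have [a ha] := descent_offset u; rewrite (preimage_descent_rcons u a) //.
by apply: measurableI => //; case: b; exact: measurable_itv.
Qed.

Lemma measurable_descent : measurable_fun setT descent.
Proof.
apply: (@measurability _ _ _ _ setT descent coord_sets) => //.
move=> _ [_ [i [b ->]] <-]; rewrite setTI.
(* A coordinate event is a finite union of cylinders, whose preimages are known to be measurable. *)
have -> : [set w : Vinf | w i = b] = \bigcup_(u : i.-tuple bool) cyl (rcons u b).
  apply/seteqP; split=> w /=.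
    move=> wi; have h : size (mkseq w i) == i by rewrite size_mkseq.
    exists (Tuple h) => //; rewrite cyl_rcons; split=> /=; rewrite ?size_mkseq //.
    by apply/cylP; rewrite size_mkseq.
  by case=> u _; rewrite cyl_rcons => -[_ /=]; rewrite size_tuple.
rewrite preimage_bigcup; apply: fin_bigcup_measurable => // u _.
exact: measurable_descent_cyl.
Qed.

HB.instance Definition _ :=
  isMeasurableFun.Build _ _ (measurableTypeR R) Vinf descent measurable_descent.

End descent.

(** * Realising prescribed cylinder masses by a probability measure *)

Definition unit_law (R : realType) : set (measurableTypeR R) -> \bar R :=
  mrestr (@lebesgue_measure R) (measurable_itv `[0%R, 1%R[).

HB.instance Definition _ (R : realType) := Measure.on (@unit_law R).

Lemma unit_law_setT (R : realType) : unit_law R setT = 1%E.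
Proof.
by rewrite /unit_law /mrestr setTI lebesgue_measure_itv /= lte01 oppr0 adde0.
Qed.

HB.instance Definition _ (R : realType) :=
  Measure_isProbability.Build _ _ _ (@unit_law R) (unit_law_setT R).

Section cylinder_extension.
Variables (R : realType) (g : word -> R).
Hypotheses (g_ge0 : forall u, 0 <= g u) (g_nil : g [::] = 1).
Hypothesis g_split : forall u, g u = g (rcons u false) + g (rcons u true).

(** Both clauses share [a] because the induction needs both: the first locates the next cut, the
    second says which interval is cut. *)
Lemma descent_itv (u : word) : exists a : R,
  (forall t : R, cyl u (descent R g t) -> (descent_state R g t (size u)).2 = t - a) /\
  (descent R g @^-1` cyl u `&` `[0, 1[ = `[a, a + g u[%classic).
Proof.
elim/last_ind: u => [|u b [a [ha hI]]].
  exists 0; split; first by move=> t _; rewrite subr0.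
  by rewrite cyl_nil preimage_setT setTI add0r g_nil.
exists (a + (if b then g (rcons u false) else 0)); split.
  exact: descent_offset_rcons.
rewrite (preimage_descent_rcons R g u a) // setIAC hI.
(* Nonnegativity of [g] keeps the cut point inside the parent interval. *)
have := g_split u; have := g_ge0 (rcons u false); have := g_ge0 (rcons u true).
move=> h1 h0 hs; apply/seteqP; split=> t; case: b; rewrite /= !in_itv /= ?andbT; lra.
Qed.

Lemma cylinder_extension : exists mu : probability Vinf R, forall u, mu (cyl u) = (g u)%:E.
Proof.
exists (distribution (unit_law R) (descent R g)) => u.
have [a [_ hI]] := descent_itv u.
transitivity (lebesgue_measure (descent R g @^-1` cyl u `&` `[0, 1[)) => //.
rewrite hI lebesgue_measure_itv /= lte_fin.
case: ifPn => h; first by rewrite -EFinD; congr EFin; ring.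
(* Here the interval is empty, and [g u] must be 0. *)
by congr EFin; have := g_ge0 u; lra.
Qed.

End cylinder_extension.

(** * Subtree fractions and weak convergence of the boundary measures *)

Theorem theorem2 (R : realType) (lam : probability Vinf R)
  (Hlam : fair_coin lam)
  (x : nat -> {fset word})
  (Htree : forall n, prefix_stable (x n))
  (Hsize : forall M : nat, exists N : nat, forall n : nat,
     (N <= n)%N -> (M <= tree_card (x n))%N) :
  ((forall u : word, cvg ((fun n => tfrac R (x n) u) @ \oo)) <->
     exists mu : probability Vinf R,
       weak_cvg (fun n => mu_tree lam (x n)) mu)
  /\
  (forall mu : probability Vinf R,
     weak_cvg (fun n => mu_tree lam (x n)) mu ->
     forall u : word, (fun n => tfrac R (x n) u) @ \oo --> fine (mu (cyl u))).
Proof.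
have x_neq0 : \forall n \near \oo, x n != fset0.
  by have [N hN] := Hsize 1; exists N => // n /= /hN; rewrite cardfs_gt0.
pose m n u := fine (mu_tree lam (x n) (cyl u)).
have diff0 u : (fun n => m n u - tfrac R (x n) u) @ \oo --> 0.
  apply/cvgrPdist_le => e e0.
  (* From [N] on, [|x_n| + 1] exceeds [1 / e]. *)
  have [N hN] := Hsize (Num.truncn e^-1).+1.
  near=> n; rewrite sub0r normrN; apply: le_trans (mu_tree_tfrac R lam (x n) (Htree n) u _) _.
    by near: n.
  rewrite -[e]invrK lef_pV2 ?posrE ?invr_gt0 ?ltr0n // ltW //.
  have := truncnS_gt e^-1.
  move=> /lt_trans; apply; rewrite ltr_nat ltnS; near: n; exists N => // n /=; exact: hN.
have cvg_m u (l : R) : (fun n => tfrac R (x n) u) @ \oo --> l -> (fun n => m n u) @ \oo --> l.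
  move=> h; have -> : m^~ u = (fun n => tfrac R (x n) u + (m n u - tfrac R (x n) u)).
    by apply/funext => n; ring.
  by rewrite -[l]addr0; exact: cvgD h (diff0 u).
have cvg_t u (l : R) : (fun n => m n u) @ \oo --> l -> (fun n => tfrac R (x n) u) @ \oo --> l.
  move=> h; have -> : (fun n => tfrac R (x n) u) = (fun n => m n u - (m n u - tfrac R (x n) u)).
    by apply/funext => n; ring.
  by rewrite -[l]subr0; exact: cvgB h (diff0 u).
(* This gives both the identification of the limit and one implication of the equivalence. *)
have weak_t (mu : probability Vinf R) : weak_cvg (fun n => mu_tree lam (x n)) mu ->
    forall u : word, (fun n => tfrac R (x n) u) @ \oo --> fine (mu (cyl u)).
  by move=> h u; apply: cvg_t; exact: cvg_cyl_weak h.
split=> //; split=> [ct|[mu hmu] u]; last first.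
  by apply/cvg_ex; eexists; exact: weak_t hmu u.
pose g u := lim ((fun n => tfrac R (x n) u) @ \oo).
have m_g u : (fun n => m n u) @ \oo --> g u by apply: cvg_m; exact: ct.
(* Only for large [n], since an empty tree yields the zero measure. *)
have total1 : \forall n \near \oo, mu_tree lam (x n) setT = 1%E.
  by near=> n; apply: mu_tree_setT => //; near: n.
have [mu hmu] : exists mu : probability Vinf R, forall u, mu (cyl u) = (g u)%:E.
  apply: cylinder_extension => [u||u].
  - by apply: limr_ge; [exact: ct|near=> n; rewrite divr_ge0].
  - rewrite -(cvg_lim (@Rhausdorff R) (m_g [::])); apply: lim_near_cst => //.
    by near=> n; rewrite /m cyl_nil (near total1 n).
  (* Additivity comes from the measures: [tfrac] also counts the node [u] itself and is additive
     only up to [1 / |x_n|]. *)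
  - apply: (cvg_unique (@Rhausdorff R) (m_g u)).
    have -> : m^~ u = (fun n => m n (rcons u false) + m n (rcons u true)).
      by apply/funext => n; rewrite /m !mu_treeE //= -mulrDl -mass_split.
    exact: cvgD.
exists mu; apply: weak_cvg_cyl => // u; rewrite hmu; exact: m_g.
Unshelve. all: by end_near. Qed.
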